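(* Let $\mathbb{F}_q$ be a finite field of characteristic at least $5$ and let $\mathcal{F}=\mathbb{F}_q(x,y)$ be a cubic function field given in standard form by $y^3-Ay+B=0$ with $A,B\in\mathbb{F}_q[x]$. Set $I=\mathrm{ind}(y)$ and $G=\gcd(I,A)$. Let $U,V,W\in\mathbb{F}_q[x]$ satisfy $$U\equiv \frac{3B}{2A} \pmod{I/G},\qquad U\equiv 0\pmod G,\qquad V\equiv -2U^2\equiv -\frac{2A}{3}\pmod{I^2}.$$ Then $\{1,\;y+W,\;(y^2+Uy+V)/I\}$ is an integral basis of $\mathcal{F}/\mathbb{F}_q(x)$.
   Context: Cubic function field in standard form: $\mathcal{F}=\mathbb{F}_q(x,y)$ where $x$ is transcendental over $\mathbb{F}_q$, $T^3-A(x)T+B(x)\in\mathbb{F}_q[x][T]$ is irreducible over $\mathbb{F}_q(x)$ with root $y$, at least one of $A,B$ is non-constant, there is no non-constant $Q\in\mathbb{F}_q[x]$ with $Q^2\mid A$ and $Q^3\mid B$, and $\mathbb{F}_q$ is algebraically closed in $\mathcal{F}$. $\mathcal{O}$ is the integral closure of $\mathbb{F}_q[x]$ in $\mathcal{F}$; an integral basis of $\mathcal{F}/\mathbb{F}_q(x)$ is an $\mathbb{F}_q[x]$-basis of $\mathcal{O}$. $\Delta=\mathrm{disc}(\mathcal{F})$ is the discriminant of an integral basis (well defined up to squares in $\mathbb{F}_q^*$), $D=\mathrm{disc}(1,y,y^2)=4A^3-27B^2$, and the index $I=\mathrm{ind}(y)\in\mathbb{F}_q[x]$ is defined, up to a constant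 factor, by $D=I^2\Delta$. It is known that $I/G$ is coprime to $A$, so that the first congruence makes sense ($1/(2A)$ denotes the inverse of $2A$ modulo $I/G$). *)

(* Defs.v *)
From HB Require Import structures.
From mathcomp Require Import all_boot all_algebra all_field.

Set Implicit Arguments.
Unset Strict Implicit.
Unset Printing Implicit Defensive.

Import GRing.Theory.
Local Open Scope ring_scope.

Notation ratfun F := {fraction {poly F}}.
Notation "p %:F" := (FracField.tofrac p) : ring_scope.

Definition congrp (F : fieldType) (M P Q : {poly F}) : Prop := M %| P - Q.

(* R is congruent to the fraction P / Q modulo M, where 1 / Q stands for an
   inverse of Q modulo M; the value does not depend on the inverse chosen. *)
Definition congrp_frac (F : fieldType) (M R P Q : {poly F}) : Prop :=
  exists2 Q', congrp M (Q * Q') 1 & congrp M R (P * Q').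

Definition standard_poly (F : fieldType) (A B : {poly F}) : {poly ratfun F} :=
  'X^3 - A%:F *: 'X + (B%:F)%:P.

Section FunctionField.

(* The transcendental generator x is the image of 'X in {fraction {poly F}}. *)
Variables (F : fieldType) (L : fieldExtType (ratfun F)).
Implicit Types (y z : L) (A B I : {poly F}).

Definition polyL : {poly F} -> L := in_alg L \o @FracField.tofrac {poly F}.
HB.instance Definition _ := GRing.RMorphism.on polyL.

Definition constL : F -> L := polyL \o polyC.
HB.instance Definition _ := GRing.RMorphism.on constL.

Record standard_form A B y : Prop := StandardForm {
  standard_irreducible : irreducible_poly (standard_poly A B);
  standard_root : root (map_poly (in_alg L) (standard_poly A B)) y;
  standard_generated : <<1; y>>%VS = fullv;
  standard_nonconstant : (1 < size A)%N \/ (1 < size B)%N;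
  standard_reduced :
    forall Q : {poly F}, Q ^+ 2 %| A -> Q ^+ 3 %| B -> (size Q <= 1)%N;
  standard_constants :
    forall z, algebraicOver constL z -> exists c : F, z = constL c
}.

Definition in_ringint z : Prop := integralOver polyL z.

(* The family b is a basis of the {poly F}-module of integral elements. *)
Definition integral_basis n (b : n.-tuple L) : Prop :=
  (forall i : 'I_n, in_ringint b`_i) /\
  (forall z, in_ringint z ->
     exists! c : {ffun 'I_n -> {poly F}}, z = \sum_(i < n) polyL (c i) * b`_i).

Definition trL z : ratfun F :=
  \tr (passmx.mxof (vbasis {:L}) (vbasis {:L}) (amulr z)).

Definition disc n (b : n.-tuple L) : ratfun F :=
  \det (\matrix_(i < n, j < n) trL (b`_i * b`_j)).

(* I is an index of y: disc (1, y, y^2) = I^2 * Delta, where Delta is the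
   discriminant of an integral basis. As Delta is only defined up to squares of
   nonzero constants, I is only defined up to a nonzero constant. *)
Definition is_index y I : Prop :=
  exists2 w : 3.-tuple L, integral_basis w &
    disc [tuple 1; y; y ^+ 2] = I%:F ^+ 2 * disc w.

End FunctionField.

(* Main.v *)
Require Import Defs.
From mathcomp Require Import all_boot all_algebra all_field ring.

Set Implicit Arguments.
Unset Strict Implicit.
Unset Printing Implicit Defensive.

Import GRing.Theory.
Local Open Scope ring_scope.

(** Write [R = {poly F}] and let [O] be the ring of integral elements of [L].
    The idea is to show that [O] has some basis of the shape [1, y, theta] with
    [I * theta = y^2 + u * y + v], to read off from the ring structure of [O]
    what [u] and [v] must be modulo [I], and to check that the hypotheses on [U]
    and [V] determine the same residues. The element of the theorem then differs
    from [theta] by an element of [R + R * y], so it is integral and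
    [1, y + W, (y^2 + U y + V) / I] is a unitriangular change of the basis
    [1, y, theta].

    Existence of [theta] ([exists_reduced_generator]). The trace of an integral
    element lies in [R]. Applied to [z, z^2, z^3] for an integral
    [z = (a + b y) / d], this gives [d | a], [d^2 | b^2 A] and [d^3 | b^3 B], and
    since the standard form is reduced, [d | b] ([integral_linear_dvdp]). Hence
    any basis of [O] can be triangularized with first two members [1, y]. The
    remaining member then has denominator exactly [I], by comparing
    determinants: the trace form is nondegenerate ([disc_neq0]), so that
    [disc (1, y, y^2) = I^2 * disc w] makes the determinant of the passage from an
    integral basis [w] to [1, y, y^2] equal to [I] or [- I].

    Residues of [u] and [v] ([generator_congruences]). The coordinates of
    [y * theta] and [theta^2] on [1, y, theta] are in [R]. This forces
    [A = 3 u^2], [v = - 2 u^2] and [B = 2 u^3] modulo [I], and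
    [u^3 - A u + B = 0] modulo [I^2]. Modulo [I], the cubic is therefore
    [(T - u)^2 (T + 2 u)] and [theta] is [(y - u) (y + 2 u) / I].

    Comparison of [U] and [u] ([index_congruence]). Modulo [I / G], where [A] is
    invertible, [3 B / (2 A) = 6 u^3 / (6 u^2) = u]. Modulo [G], [U] vanishes,
    and so does [u]: [G | 3 u^2], and the part of [G] that might fail to divide
    [u] would contradict the reducedness of the standard form. As [I / G] and [G]
    are coprime, [U = u] modulo [I], and then [V = - 2 U^2 = - 2 u^2 = v]. *)

(** * Divisibility of polynomials *)

Lemma dvdp_natrMl (F : fieldType) (n : nat) (d a : {poly F}) :
  n%:R != 0 :> F -> d %| n%:R * a -> d %| a.
Proof. by move=> n0; rewrite -polyC_natr mul_polyC dvdpZr. Qed.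

Lemma natr_poly_neq0 (F : fieldType) (n : nat) :
  n%:R != 0 :> F -> n%:R != 0 :> {poly F}.
Proof. by rewrite -polyC_natr polyC_eq0. Qed.

Lemma Bezout3 (F : fieldType) (n : 'I_3 -> {poly F}) :
  exists r : 'I_3 -> {poly F}, forall j, \sum_i r i * n i %| n j.
Proof.
have [[u0 u1] /= gu] := Bezoutp (n 0) (n 1).
set g := u0 * n 0 + u1 * n 1 in gu.
have [[v0 v1] /= hv] := Bezoutp g (n (inord 2)).
exists (fun i => nth 0 [:: v0 * u0; v0 * u1; v1] i) => j.
set e := \sum_i _.
have eE : e = v0 * g + v1 * n (inord 2).
  rewrite /e !big_ord_recr big_ord0 /= /g.
  rewrite (_ : widen_ord _ (widen_ord _ ord_max) = 0); last exact/val_inj.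
  rewrite (_ : widen_ord _ ord_max = 1); last exact/val_inj.
  rewrite (_ : ord_max = inord 2); last by apply/val_inj; rewrite /= inordK.
  by ring.
have eg : e %| g by rewrite eE (eqp_dvdl _ hv) dvdp_gcdl.
have [e0 e1] : e %| n 0 /\ e %| n 1.
  by split; apply: (dvdp_trans eg); rewrite (eqp_dvdl _ gu) ?dvdp_gcdl ?dvdp_gcdr.
have e2 : e %| n (inord 2) by rewrite eE (eqp_dvdl _ hv) dvdp_gcdr.
by case: j => [[|[|[|j]]] //= lt_j]; [move: e0 | move: e1 | move: e2];
  congr (_ %| n _); apply/val_inj; rewrite //= ?inordK.
Qed.

(** The three congruences on [u] are those satisfied by the coefficient of [y] in
    the third member of an integral basis. They agree with the conditions on [U]
    modulo [I / G], where [U] and [u] are both [3 B / (2 A)], and modulo [G], where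
    both vanish; the two moduli are coprime. *)
Lemma index_congruence (F : fieldType) (A B I G u U Q' : {poly F}) :
  3%:R != 0 :> F ->
  (forall Q : {poly F}, Q ^+ 2 %| A -> Q ^+ 3 %| B -> (size Q <= 1)%N) ->
  I != 0 -> G %| I -> G %| A ->
  I %| A - 3%:R * u ^+ 2 -> I %| B - 2%:R * u ^+ 3 ->
  I ^+ 2 %| u ^+ 3 - A * u + B ->
  I ^+ 2 %| A - 3%:R * U ^+ 2 -> G %| U ->
  I %/ G %| 2%:R * A * Q' - 1 -> I %/ G %| U - 3%:R * B * Q' ->
  I %| U - u.
Proof.
move=> three0 reduced I0 GI GA Iu2 Iu3 If IU GU JQ JU.
have G0 : G != 0 by apply: contraNneq I0 => G0; rewrite G0 dvd0p in GI.
have G2I2 : G ^+ 2 %| I ^+ 2 by rewrite dvdp_exp2r.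
have G2A : G ^+ 2 %| A.
  rewrite -(subrK (3%:R * U ^+ 2) A) dvdp_add //; first exact: dvdp_trans IU.
  by apply/dvdp_mull/dvdp_exp2r.
have Gu2 : G %| u ^+ 2.
  apply: (dvdp_natrMl (n := 3) three0).
  by rewrite -(dvdp_subr _ GA) (dvdp_trans GI).
have Gu : G %| u.
  (* With h = gcd (G, u) and G = k h, the divisibility of u^2 by G gives
     k | h | u, whence k^4 | G^2. Then k^2 | A and k^3 | B, so k is constant. *)
  have [[s t] /= hE] := Bezoutp G u; set h := s * G + t * u in hE.
  have hG : h %| G by rewrite (eqp_dvdl _ hE) dvdp_gcdl.
  have hu : h %| u by rewrite (eqp_dvdl _ hE) dvdp_gcdr.
  have h0 : h != 0 by apply: contraNneq G0 => h0; rewrite h0 dvd0p in hG.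
  have Gh2 : G %| h ^+ 2.
    have -> : h ^+ 2 = G * (s ^+ 2 * G + 2%:R * s * t * u) + t ^+ 2 * u ^+ 2.
      by rewrite /h; ring.
    by apply: dvdp_add; [apply: dvdp_mulr | apply: dvdp_mull].
  have [k GE] := dvdpP _ _ hG.
  have kh : k %| h by move: Gh2; rewrite GE expr2 dvdp_mul2r.
  have k2G : k ^+ 2 %| G by rewrite GE expr2 dvdp_mul.
  have k4G2 : k ^+ 4 %| G ^+ 2 by rewrite (exprM k 2 2) dvdp_exp2r.
  have k3G2 : k ^+ 3 %| G ^+ 2 by apply: dvdp_trans k4G2; rewrite dvdp_exp2l.
  have k2A : k ^+ 2 %| A.
    by apply: dvdp_trans G2A; apply: dvdp_trans k4G2; rewrite dvdp_exp2l.
  have k3B : k ^+ 3 %| B.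
    rewrite -(dvdp_addr (m := u ^+ 3 - A * u)).
      by apply: dvdp_trans If; apply: dvdp_trans G2I2.
    apply: dvdp_sub; first exact/dvdp_exp2r/(dvdp_trans kh).
    exact/dvdp_mulr/(dvdp_trans k3G2).
  have k0 : k != 0 by apply: contraNneq G0 => k0; rewrite GE k0 mul0r.
  rewrite GE (size1_polyC (reduced _ k2A k3B)) mul_polyC dvdpZl //.
  by rewrite -polyC_eq0 -size1_polyC // reduced.
rewrite -(divpK GI); set J := I %/ G in JQ JU *.
have JI : J %| I by rewrite -(divpK GI) dvdp_mulr.
(* A is invertible modulo I / G and zero modulo G. *)
have copJG : coprimep J G.
  apply/coprimepP => d dJ dG; rewrite -size_poly_eq1 -dvdp1.
  have dA : d %| 2%:R * A * Q' by rewrite dvdp_mulr // dvdp_mull // (dvdp_trans dG).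
  by rewrite -(dvdp_subr _ dA) (dvdp_trans dJ).
rewrite Gauss_dvdp //; apply/andP; split; last by rewrite dvdp_sub.
(* Modulo J, U = 3 B Q' = 6 u^3 Q' = 2 u A Q' = u. *)
have -> : U - u = (U - 3%:R * B * Q') + 3%:R * Q' * (B - 2%:R * u ^+ 3)
    - 2%:R * u * Q' * (A - 3%:R * u ^+ 2) + u * (2%:R * A * Q' - 1) by ring.
apply: dvdp_add; last exact: dvdp_mull.
apply: dvdp_sub; last exact/dvdp_mull/(dvdp_trans JI).
by apply: dvdp_add => //; apply/dvdp_mull/(dvdp_trans JI).
Qed.

(** * The trace form *)

Section TraceForm.

Variables (F : fieldType) (L : fieldExtType (ratfun F)).
Implicit Types (z : L) (a : {poly F}).

Lemma polyLE a z : polyL L a * z = a%:F *: z.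
Proof. by rewrite /polyL /= mulr_algl. Qed.

Lemma polyL_eq0 a : (polyL L a == 0) = (a == 0).
Proof. by rewrite /polyL /= scaler_eq0 oner_eq0 orbF tofrac_eq0. Qed.

Lemma trL_linear (c : ratfun F) (z z' : L) :
  trL (c *: z + z') = c * trL z + trL z'.
Proof.
rewrite /trL; set e := vbasis _.
have -> : amulr (c *: z + z') = c *: amulr z + amulr z'.
  by apply/lfunP => v; do !rewrite lfunE /=; rewrite mulrDr scalerAr.
by rewrite passmx.mxof_linear mxtraceD mxtraceZ.
Qed.

(** The trace is defined with a chosen basis; it is the same in every basis [b]
    because the two matrices are conjugate. The sizes [n] and [\dim {:L}] are only
    propositionally equal, so the passage matrices [P] and [Q] are rectangular,
    which the cyclicity of the trace allows. *)
Lemma trL_basis n (b : n.-tuple L) (M : 'M[ratfun F]_n) z :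
  basis_of {:L} b -> (forall i : 'I_n, z * b`_i = \sum_j M i j *: b`_j) ->
  trL z = \tr M.
Proof.
move=> bb zb; set e := vbasis {:L}.
have eb : basis_of {:L} e := vbasisP _.
set X := passmx.mxof e e (amulr z).
pose P := \matrix_(i < n, k < \dim {:L}) coord e k b`_i.
pose Q := \matrix_(k < \dim {:L}, i < n) coord b i e`_k.
have free_b := basis_free bb; have free_e := basis_free eb.
have bP (i : 'I_n) : b`_i = \sum_k P i k *: e`_k.
  by rewrite {1}(coord_basis eb (memvf b`_i)); apply: eq_bigr => k _; rewrite mxE.
have eQ (k : 'I_(\dim {:L})) : e`_k = \sum_i Q k i *: b`_i.
  by rewrite {1}(coord_basis bb (memvf e`_k)); apply: eq_bigr => i _; rewrite mxE.
have eX (k : 'I_(\dim {:L})) : z * e`_k = \sum_l X k l *: e`_l.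
  rewrite {1}(coord_basis eb (memvf (z * _))); apply: eq_bigr => l _; congr (_ *: _).
  by rewrite !mxE /= passmx.vecof_delta lfunE /= mulrC.
have QP : Q *m P = 1%:M.
  apply/matrixP => k l; rewrite !mxE -(coord_free k l free_e) {1}eQ linear_sum /=.
  by apply: eq_bigr => i _; rewrite linearZ /= [P _ _]mxE.
have XQ : X *m Q = Q *m M.
  apply/matrixP => k i; rewrite !mxE.
  transitivity (coord b i (z * e`_k)).
    by rewrite eX linear_sum; apply: eq_bigr => l _; rewrite linearZ /= [Q _ _]mxE.
  rewrite eQ mulr_sumr linear_sum /=; apply: eq_bigr => j _.
  by rewrite -scalerAr linearZ /= zb coord_sum_free.
have PQ : P *m Q = 1%:M.
  apply/matrixP => i j; rewrite !mxE -(coord_free i j free_b) {1}bP linear_sum /=.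
  by apply: eq_bigr => k _; rewrite linearZ /= [Q _ _]mxE.
by rewrite /trL -/X -[X]mulmx1 -QP mulmxA XQ mxtrace_mulC mulmxA PQ mul1mx.
Qed.

Lemma trL1 n (b : n.-tuple L) : basis_of {:L} b -> trL (1 : L) = n%:R.
Proof.
move=> bb; rewrite (trL_basis (M := 1%:M) bb) ?mxtrace1 // => i.
rewrite mul1r (bigD1 i) //= big1 => [|j ji]; first by rewrite mxE eqxx scale1r addr0.
by rewrite mxE eq_sym (negPf ji) scale0r.
Qed.

Lemma in_ringint_poly a : in_ringint (polyL L a).
Proof. exact: integral_id. Qed.

Lemma in_ringintD z z' : in_ringint z -> in_ringint z' -> in_ringint (z + z').
Proof. exact: integral_add. Qed.

Lemma in_ringintM z z' : in_ringint z -> in_ringint z' -> in_ringint (z * z').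
Proof. exact: integral_mul. Qed.

Lemma in_ringintB z z' : in_ringint z -> in_ringint z' -> in_ringint (z - z').
Proof. exact: integral_sub. Qed.

Lemma trL0 : trL (0 : L) = 0.
Proof. by have := trL_linear (-1) (0 : L) 0; rewrite scaler0 addr0 mulN1r addNr. Qed.

Lemma trLZ (c : ratfun F) z : trL (c *: z) = c * trL z.
Proof. by have := trL_linear c z 0; rewrite !addr0 trL0 addr0. Qed.

Lemma trL_sumr (n : nat) (k : 'I_n -> ratfun F) (u : 'I_n -> L) z :
  trL (z * \sum_j k j *: u j) = \sum_j k j * trL (z * u j).
Proof.
rewrite mulr_sumr; apply: (big_rec2 (fun s t => trL s = t)).
  exact: trL0.
by move=> j t s _ <-; rewrite -scalerAr trL_linear.
Qed.

(** The radical of the trace form is an ideal of the field [L], and it does not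
    contain 1, whose trace is the degree. *)
Lemma disc_neq0 n (b : n.-tuple L) :
  basis_of {:L} b -> n%:R != 0 :> ratfun F -> disc b != 0.
Proof.
move=> bb n0; apply/negP => /det0P[v v0 vT].
pose x := \sum_i v 0 i *: b`_i.
have x0 : x != 0.
  apply: contra v0 => /eqP x0; apply/eqP/rowP => i; rewrite [RHS]mxE.
  by move/freeP: (basis_free bb) => /(_ (fun i => v 0 i) x0 i).
have xb (j : 'I_n) : trL (b`_j * x) = 0.
  rewrite trL_sumr; have /rowP/(_ j) := vT; rewrite !mxE => vTj.
  by rewrite -[RHS]vTj; apply: eq_bigr => i _; rewrite mxE [b`_j * _]mulrC.
have : trL (x * x^-1) = 0.
  rewrite (coord_basis bb (memvf x^-1)) trL_sumr big1 // => j _.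
  by rewrite [x * _]mulrC xb mulr0.
by rewrite mulfV // (trL1 bb) => /eqP; rewrite (negPf n0).
Qed.

Lemma disc_change n (b w : n.-tuple L) (M : 'M[ratfun F]_n) :
  (forall k : 'I_n, b`_k = \sum_i M k i *: w`_i) ->
  disc b = \det M ^+ 2 * disc w.
Proof.
move=> bM; rewrite /disc; set T := \matrix_(i, j) trL (w`_i * w`_j).
suff -> : \matrix_(i < n, j < n) trL (b`_i * b`_j) = M *m T *m M^T.
  by rewrite !det_mulmx det_tr mulrAC expr2.
apply/matrixP => i j; rewrite !mxE [b`_j]bM trL_sumr; apply: eq_bigr => k _.
rewrite [b`_i * _]mulrC bM trL_sumr !mxE mulrC; congr (_ * _); apply: eq_bigr => l _.
by rewrite !mxE [w`_k * _]mulrC mulrC.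
Qed.

Lemma integral_basis_of n (b w : n.-tuple L) :
  integral_basis w -> basis_of {:L} b -> (forall i : 'I_n, in_ringint b`_i) ->
  basis_of {:L} w.
Proof.
move=> [_ spanw] bb Ob; rewrite basisEdim size_tuple (size_basis bb) leqnn andbT.
rewrite -(span_basis bb); apply/span_subvP => _ /seq_tnthP[i ->].
rewrite (tnth_nth 0); case: (spanw _ (Ob (cast_ord (size_tuple b) i))) => c [-> _].
apply: memv_suml => j _; rewrite polyLE memvZ // memv_span //.
by rewrite -tnth_nth mem_tnth.
Qed.

(** Multiplication by an integral element has a polynomial matrix in an integral
    basis. *)
Lemma integral_trL n (w : n.-tuple L) z :
  integral_basis w -> basis_of {:L} w -> in_ringint z ->
  exists t : {poly F}, trL z = t%:F.
Proof.
move=> [Ow spanw] bw Oz.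
have zw (i : 'I_n) : exists c : {ffun 'I_n -> {poly F}},
    z * w`_i = \sum_j polyL L (c j) * w`_j.
  by case: (spanw _ (integral_mul Oz (Ow i))) => c [zc _]; exists c.
have [c zc] := fin_all_exists zw.
exists (\tr (\matrix_(i, j) c i j)).
rewrite (trL_basis (M := \matrix_(i, j) (c i j)%:F) bw) => [|i].
  by rewrite rmorph_sum; apply: eq_bigr => i _; rewrite !mxE.
by rewrite zc; apply: eq_bigr => j _; rewrite mxE polyLE.
Qed.

End TraceForm.

(** * The ring of integers of a cubic function field *)

Section Cubic.

Variables (F : fieldType) (L : fieldExtType (ratfun F)).
Variables (A B : {poly F}) (y : L).
Hypothesis std : standard_form A B y.
Implicit Types (z : L) (a b c d : {poly F}).

Let f := standard_poly A B.

Lemma size_standard_poly : size f = 4.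
Proof.
rewrite /f /standard_poly -addrA size_polyDl ?size_polyXn //.
rewrite (leq_ltn_trans (size_polyD _ _)) // gtn_max size_polyN.
rewrite (leq_ltn_trans (size_scale_leq _ _)) ?size_polyX //=.
by rewrite (leq_ltn_trans (size_polyC_leq1 _)).
Qed.

Lemma cubic_rel : y ^+ 3 = polyL L A * y - polyL L B.
Proof.
have /rootP := standard_root std.
rewrite /standard_poly rmorphD rmorphB /= map_polyZ !map_polyXn map_polyX map_polyC /=.
rewrite !hornerE => /eqP.
by rewrite -addrA addr_eq0 opprD opprK => /eqP ->; rewrite /polyL.
Qed.

Lemma cubic_rel4 : y ^+ 4 = polyL L A * y ^+ 2 - polyL L B * y.
Proof. by rewrite exprSr cubic_rel; ring. Qed.

(** The irreducible cubic either divides [p], which its size excludes unless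
    [p = 0], or is coprime to [p], and then the two have no common root. *)
Lemma minpoly_free (p : {poly ratfun F}) :
  (size p <= 3)%N -> (map_poly (in_alg L) p).[y] = 0 -> p = 0.
Proof.
move=> sp py; apply/eqP; apply: contraT => p0.
have irr := standard_irreducible std; rewrite -/f in irr.
have [] := irredp_XsubCP irr (dvdp_gcdl f p).
  rewrite gcdp_eqp1 -(coprimep_map (in_alg L)) => cop.
  by have := coprimep_root cop (standard_root std); rewrite py eqxx.
rewrite eqp_sym => /eqp_dvdl fE.
have := dvdp_leq p0 (etrans (fE p) (dvdp_gcdr f p)).
by rewrite size_standard_poly leqNgt (leq_ltn_trans sp).
Qed.

Lemma basis_of_powers : basis_of {:L} [tuple 1; y; y ^+ 2].
Proof.
have powE (k : nat -> ratfun F) :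
    \sum_(i < 3) k i *: [tuple 1; y; y ^+ 2]`_i
      = (map_poly (in_alg L) (\poly_(i < 3) k i)).[y].
  rewrite (horner_coef_wide _ (n := 3)) ?size_map_poly ?size_poly //.
  by rewrite !big_ord_recr !big_ord0 /= !coef_map !coef_poly /= !mulr_algl.
rewrite /basis_of; apply/andP; split; last first.
  apply/freeP => k k0 i; pose k' j := k (inord j).
  have k'0 : \poly_(i < 3) k' i = 0.
    apply: minpoly_free; rewrite ?size_poly // -powE -[RHS]k0.
    by apply: eq_bigr => j _; rewrite /k' inord_val.
  by have /polyP/(_ i) := k'0; rewrite coef_poly ltn_ord coef0 /k' inord_val.
rewrite eqEsubv subvf /=; apply/subvP => z _.
have /Fadjoin1_polyP[p ->] : z \in <<1; y>>%VS by rewrite (standard_generated std) memvf.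
rewrite (divp_eq p f) rmorphD rmorphM hornerD hornerM /=.
have /rootP := standard_root std; rewrite -/f => ->; rewrite mulr0 add0r.
rewrite (horner_coef_wide _ (n := 3)) ?size_map_poly; last first.
  have f0 : f != 0 by rewrite -size_poly_gt0 size_standard_poly.
  by have := ltn_modpN0 p f0; rewrite size_standard_poly.
apply: memv_suml => i _; rewrite coef_map mulr_algl memvZ // memv_span //.
by case: i => [[|[|[|i]]] //= _]; rewrite !inE ?expr0 ?expr1 eqxx ?orbT.
Qed.

Definition ypoly a b c : L := polyL L a + polyL L b * y + polyL L c * y ^+ 2.

Lemma ypoly_inj a b c a' b' c' :
  ypoly a b c = ypoly a' b' c' -> [/\ a = a', b = b' & c = c'].
Proof.
move=> e; pose k (i : 'I_3) : ratfun F := ([:: a - a'; b - b'; c - c']`_i)%:F.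
have k0 : \sum_(i < 3) k i *: [tuple 1; y; y ^+ 2]`_i = 0.
  transitivity (ypoly a b c - ypoly a' b' c'); last by rewrite e subrr.
  by rewrite !big_ord_recr big_ord0 /= /k /= -!polyLE !rmorphB /ypoly; ring.
have /freeP/(_ k k0) fk := basis_free basis_of_powers.
have t0 p : p%:F = 0 :> ratfun F -> p = 0 by move/eqP; rewrite tofrac_eq0 => /eqP.
have /t0/eqP := fk 0; have /t0/eqP := fk 1; have /t0/eqP := fk (inord 2).
by rewrite !inordK //= !subr_eq0 => /eqP-> /eqP-> /eqP->.
Qed.

Lemma in_ringint_y : in_ringint y.
Proof.
pose q : {poly {poly F}} := - A *: 'X + B%:P; pose p := 'X^3 + q.
have sq : (size q < 4)%N.
  rewrite (leq_ltn_trans (size_polyD _ _)) // gtn_max.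
  rewrite (leq_ltn_trans (size_scale_leq _ _)) ?size_polyX //=.
  by rewrite (leq_ltn_trans (size_polyC_leq1 _)).
exists p; first by rewrite monicE lead_coefDl ?lead_coefXn ?size_polyXn.
apply/rootP; rewrite /p /q !rmorphD /= map_polyZ map_polyXn map_polyX map_polyC /=.
by rewrite !hornerE cubic_rel rmorphN /=; ring.
Qed.

Lemma trL_y : trL y = 0.
Proof.
pose M : 'M[ratfun F]_3 := \matrix_(i < 3, j < 3)
  nth 0 (nth [::] [:: [:: 0; 1; 0]; [:: 0; 0; 1]; [:: - B%:F; A%:F; 0]] i) j.
rewrite (trL_basis (M := M) basis_of_powers) => [|i].
  by rewrite /mxtrace !big_ord_recr big_ord0 /= !mxE /= !addr0.
rewrite !big_ord_recr big_ord0 /= !mxE /= add0r.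
case: i => [[|[|[|i]]] //= _]; rewrite ?scale0r ?scale1r ?addr0 ?add0r ?mulr1 ?expr2 //.
by rewrite -expr2 -exprS cubic_rel scaleNr -!polyLE; ring.
Qed.

Lemma trL_y2 : trL (y ^+ 2) = 2%:R * A%:F.
Proof.
pose M : 'M[ratfun F]_3 := \matrix_(i < 3, j < 3)
  nth 0 (nth [::] [:: [:: 0; 0; 1]; [:: - B%:F; A%:F; 0]; [:: 0; - B%:F; A%:F]] i) j.
rewrite (trL_basis (M := M) basis_of_powers) => [|i].
  by rewrite /mxtrace !big_ord_recr big_ord0 /= !mxE /=; ring.
rewrite !big_ord_recr big_ord0 /= !mxE /= add0r.
case: i => [[|[|[|i]]] //= _]; rewrite ?scale0r ?scale1r ?addr0 ?add0r ?mulr1 //.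
  by rewrite -exprSr cubic_rel scaleNr -!polyLE; ring.
by rewrite -exprD cubic_rel4 scaleNr -!polyLE; ring.
Qed.

Lemma trL_y3 : trL (y ^+ 3) = - (3%:R * B%:F).
Proof.
have -> : y ^+ 3 = A%:F *: y + (- B%:F) *: 1.
  by rewrite cubic_rel scaleNr -!polyLE mulr1.
by rewrite trL_linear trLZ trL_y (trL1 basis_of_powers); ring.
Qed.

Variable w : 3.-tuple L.
Hypotheses (two_neq0 : 2%:R != 0 :> F) (three_neq0 : 3%:R != 0 :> F).
Hypothesis basis_w : integral_basis w.

Lemma in_ringint_powers (i : 'I_3) : in_ringint [tuple 1; y; y ^+ 2]`_i.
Proof.
have Oy := in_ringint_y.
case: i => [[|[|[|i]]] //= _]; [exact: integral1|].
by rewrite expr2; apply: in_ringintM.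
Qed.

Lemma basis_of_integral_basis : basis_of {:L} w.
Proof. exact: integral_basis_of basis_w basis_of_powers in_ringint_powers. Qed.

Lemma trL_dvdp z d q : in_ringint z -> trL (polyL L d * z) = q%:F -> d %| q.
Proof.
move=> Oz; have [t tz] := integral_trL basis_w basis_of_integral_basis Oz.
rewrite polyLE trLZ tz -rmorphM => /eqP; rewrite tofrac_eq => /eqP <-.
exact: dvdp_mulr.
Qed.

(** With [z = b y / d], the traces [2 A b^2 / d^2] of [z^2] and [- 3 B b^3 / d^3]
    of [z^3] are polynomials. If [d'] is the denominator of [b / d] in lowest terms,
    then [d'^2 | A] and [d'^3 | B], so [d'] is constant in a standard form. *)
Lemma integral_monomial_dvdp z d b : d != 0 -> in_ringint z ->
  polyL L d * z = polyL L b * y -> d %| b.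
Proof.
move=> d0 Oz dz.
have d2 : d ^+ 2 %| b ^+ 2 * A.
  apply: (dvdp_natrMl (n := 2) two_neq0).
  apply: (@trL_dvdp (z ^+ 2)); first by rewrite expr2; apply: in_ringintM.
  have -> : polyL L (d ^+ 2) * z ^+ 2 = polyL L (b ^+ 2) * y ^+ 2.
    by rewrite !rmorphXn -!exprMn dz.
  by rewrite polyLE trLZ trL_y2; ring.
have d3 : d ^+ 3 %| b ^+ 3 * B.
  apply: (dvdp_natrMl (n := 3) three_neq0); rewrite -dvdpNr.
  apply: (@trL_dvdp (z ^+ 3)).
    by rewrite exprS expr2; do ![apply: in_ringintM => //].
  have -> : polyL L (d ^+ 3) * z ^+ 3 = polyL L (b ^+ 3) * y ^+ 3.
    by rewrite !rmorphXn -!exprMn dz.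
  by rewrite polyLE trLZ trL_y3; ring.
have g0 : gcdp d b != 0 by rewrite gcdp_eq0 (negPf d0).
set g := gcdp d b in g0; set d' := d %/ g; set b' := b %/ g.
have dE : d = d' * g by rewrite divpK ?dvdp_gcdl.
have bE : b = b' * g by rewrite divpK ?dvdp_gcdr.
have cop : coprimep d' b'.
  by have := coprimep_div_gcd (p := d) (q := b); rewrite d0 => /(_ isT).
have d'2 : d' ^+ 2 %| A.
  move: d2; rewrite dE bE !exprMn [_ * A]mulrAC dvdp_mul2r ?expf_neq0 //.
  by rewrite Gauss_dvdpr // coprimep_expl // coprimep_expr.
have d'3 : d' ^+ 3 %| B.
  move: d3; rewrite dE bE !exprMn [_ * B]mulrAC dvdp_mul2r ?expf_neq0 //.
  by rewrite Gauss_dvdpr // coprimep_expl // coprimep_expr.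
have sd' := standard_reduced std d'2 d'3.
have d'0 : d' != 0 by apply: contraNneq d0 => d'0; rewrite dE d'0 mul0r.
rewrite dE bE dvdp_mul2r //.
rewrite (size1_polyC sd') -[_%:P]mulr1 mul_polyC dvdpZl ?dvd1p //.
by rewrite -polyC_eq0 -size1_polyC.
Qed.

(** The trace of [z] is [3 a / d], so [d | a]; what remains of [z] is [b y / d],
    up to a polynomial. In other words, the second member of a triangular
    integral basis has no denominator. *)
Lemma integral_linear_dvdp z d a b : d != 0 -> in_ringint z ->
  polyL L d * z = polyL L a + polyL L b * y -> d %| a /\ d %| b.
Proof.
move=> d0 Oz dz.
have da : d %| a.
  apply: (dvdp_natrMl (n := 3) three_neq0); apply: (trL_dvdp Oz).
  rewrite dz -[polyL L a]mulr1 !polyLE trL_linear trLZ trL_y.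
  by rewrite (trL1 basis_of_powers); ring.
split=> //; apply: (@integral_monomial_dvdp (z - polyL L (a %/ d))) => //.
  by apply: in_ringintB => //; apply: in_ringint_poly.
by rewrite mulrBr dz -rmorphM [d * _]mulrC divpK // addrAC subrr add0r.
Qed.

Variable I : {poly F}.
Hypothesis disc_y : disc [tuple 1; y; y ^+ 2] = I%:F ^+ 2 * disc w.

Lemma three_ratfun_neq0 : 3%:R != 0 :> ratfun F.
Proof.
by rewrite -(rmorph_nat (@FracField.tofrac {poly F})) tofrac_eq0 natr_poly_neq0.
Qed.

Lemma index_neq0 : I != 0.
Proof.
have := disc_neq0 basis_of_powers three_ratfun_neq0; rewrite disc_y.
by apply: contraNneq => ->; rewrite rmorph0 expr2 !mul0r.
Qed.

(** Let [M] be the matrix of [1, y, y^2] in the basis [w]; its determinant [delta]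
    is [I] up to sign, and the rows of [N = \adj M] are the coordinates of the
    [delta * w_i] on [1, y, y^2]. A Bezout combination [th] of the [w_i] has
    leading coordinate [e], the gcd of the last column of [N]. Subtracting
    multiples of [th] from the [w_i] leaves integral elements of degree at most
    one in [y], which are in [R + R y]. This factors [N] through a triangular
    matrix of determinant [delta^2 * e], whereas [\det N = delta^2]: so [e] is a
    unit. *)
Lemma exists_reduced_generator : exists theta u v,
  [/\ in_ringint theta, polyL L I * theta = ypoly v u 1 &
      forall z, in_ringint z ->
        exists a b c, z = polyL L a + polyL L b * y + polyL L c * theta].
Proof.
have [Ow spanw] := basis_w.
have powers_w (k : 'I_3) : exists c : {ffun 'I_3 -> {poly F}},
    [tuple 1; y; y ^+ 2]`_k = \sum_i polyL L (c i) * w`_i.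
  by case: (spanw _ (in_ringint_powers k)) => c [kc _]; exists c.
have [c cE] := fin_all_exists powers_w.
pose M : 'M[{poly F}]_3 := \matrix_(k, i) c k i.
(* The value of delta is abstracted: it would otherwise unfold to a sum in the
   rewritings with big operators below. *)
pose N := \adj M; have [delta dM] : exists d, \det M = d by eexists.
have delta2 : delta ^+ 2 = I ^+ 2.
  have dw0 := disc_neq0 basis_of_integral_basis three_ratfun_neq0.
  have := @disc_change _ _ _ [tuple 1; y; y ^+ 2] w (map_mx (@FracField.tofrac _) M).
  rewrite det_map_mx dM disc_y => /(_ _)/(mulIf dw0) dI.
  apply/eqP; rewrite -tofrac_eq !rmorphXn /= dI // => k; rewrite cE.
  by apply: eq_bigr => i _; rewrite !mxE polyLE.
have delta0 : delta != 0 by rewrite -sqrf_eq0 delta2 sqrf_eq0 index_neq0.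
have wN (i : 'I_3) :
    polyL L delta * w`_i = \sum_k polyL L (N i k) * [tuple 1; y; y ^+ 2]`_k.
  transitivity (\sum_j polyL L ((N *m M) i j) * w`_j).
    rewrite mul_adj_mx dM (bigD1 i) //= big1 => [|j ji]; first by rewrite mxE eqxx addr0.
    by rewrite mxE eq_sym (negPf ji) rmorph0 mul0r.
  under [RHS]eq_bigr do rewrite cE mulr_sumr.
  rewrite exchange_big; apply: eq_bigr => j _; rewrite mxE rmorph_sum mulr_suml.
  by apply: eq_bigr => k _; rewrite [M _ _]mxE rmorphM mulrA.
have detN : \det N = delta ^+ 2.
  apply: (mulfI delta0); rewrite -exprS.
  by have := det_mulmx M N; rewrite mul_mx_adj dM det_scalar => ->.
pose k0 : 'I_3 := inord 0; pose k1 : 'I_3 := inord 1; pose k2 : 'I_3 := inord 2.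
have [r rN] := Bezout3 (fun i => N i k2).
have [e eE] : exists e, e = \sum_i r i * N i k2 by eexists.
rewrite -eE in rN.
pose a := \sum_i r i * N i k0; pose b := \sum_i r i * N i k1.
pose q i := N i k2 %/ e; have qE i : N i k2 = q i * e by rewrite divpK.
have wE (i : 'I_3) : polyL L delta * w`_i = ypoly (N i k0) (N i k1) (N i k2).
  rewrite wN !big_ord_recr big_ord0 /= /ypoly.
  rewrite (_ : widen_ord _ (widen_ord _ ord_max) = k0); last first.
    by apply/val_inj; rewrite /= inordK.
  rewrite (_ : widen_ord _ ord_max = k1); last by apply/val_inj; rewrite /= inordK.
  rewrite (_ : ord_max = k2); last by apply/val_inj; rewrite /= inordK.
  by ring.
pose th := \sum_i polyL L (r i) * w`_i.
have Oth : in_ringint th.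
  rewrite /th; apply: big_ind => [||i _]; [exact: integral0 | exact: in_ringintD|].
  by apply: in_ringintM (Ow i); apply: in_ringint_poly.
have thE : polyL L delta * th = ypoly a b e.
  rewrite /th /a /b eE /ypoly !rmorph_sum !mulr_suml mulr_sumr -!big_split /=.
  by apply: eq_bigr => i _; rewrite mulrCA wE /ypoly !rmorphM; ring.
have rest (i : 'I_3) : exists st : {poly F} * {poly F},
    w`_i = polyL L st.1 + polyL L st.2 * y + polyL L (q i) * th
    /\ N i k0 = st.1 * delta + q i * a /\ N i k1 = st.2 * delta + q i * b.
  have Oi : in_ringint (w`_i - polyL L (q i) * th).
    by apply: in_ringintB (Ow i) _; apply: in_ringintM (Oth); apply: in_ringint_poly.
  have dE : polyL L delta * (w`_i - polyL L (q i) * th)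
      = polyL L (N i k0 - q i * a) + polyL L (N i k1 - q i * b) * y.
    by rewrite mulrBr mulrCA thE wE qE /ypoly; ring.
  have [/dvdpP[s sE] /dvdpP[t tE]] := integral_linear_dvdp delta0 Oi dE.
  exists (s, t); split=> /=; last by rewrite -sE -tE !subrK.
  apply: (mulfI (x := polyL L delta)); first by rewrite polyL_eq0.
  rewrite -[w`_i](subrK (polyL L (q i) * th)) mulrDr dE sE tE; ring.
have [st stE] := fin_all_exists rest.
pose Q : 'M[{poly F}]_3 := \matrix_(i, j) nth 0 [:: (st i).1; (st i).2; q i] j.
pose T : 'M[{poly F}]_3 := \matrix_(i, j)
  nth 0 (nth [::] [:: [:: delta]; [:: 0; delta]; [:: a; b; e]] i) j.
have NQT : N = Q *m T.
  have QE i j : Q i j = nth 0 [:: (st i).1; (st i).2; q i] j by rewrite mxE.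
  have TE i j : T i j
      = nth 0 (nth [::] [:: [:: delta]; [:: 0; delta]; [:: a; b; e]] i) j.
    by rewrite mxE.
  apply/matrixP => i j; rewrite [RHS]mxE !big_ord_recr big_ord0 /= !QE !TE /=.
  have [_ [Ni0 Ni1]] := stE i.
  have [|[|]] : j = k0 \/ j = k1 \/ j = k2.
    by case: j => [[|[|[|j]]] //= lt_j]; [left|right; left|right; right];
      apply/val_inj; rewrite /= inordK.
  - by move=> ->; rewrite inordK //= Ni0; ring.
  - by move=> ->; rewrite inordK //= Ni1; ring.
  - by move=> ->; rewrite inordK //= qE; ring.
have e1 : e %| 1.
  have : \det N = \det Q * \det T by rewrite NQT det_mulmx.
  rewrite detN (det_trig (A := T)); last first.
    by apply/is_trig_mxP => -[[|[|[|i]]] //= ?] [[|[|[|j]]] //= ?]; rewrite mxE.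
  rewrite !big_ord_recr big_ord0 /= !mxE /= => dQ; apply/dvdpP; exists (\det Q).
  by apply: (mulfI (x := delta ^+ 2)); rewrite ?expf_neq0 // mulr1 [LHS]dQ; ring.
(* Multiplying th by the inverse of e and the sign s makes it monic over I. *)
have [s [ss sE]] : exists s, s * s = 1 /\ I = s * delta.
  have /eqP := delta2; rewrite eqf_sqr => /orP[] /eqP ->.
    by exists 1; rewrite !mul1r.
  by exists (-1); rewrite mulrNN mulN1r opprK mul1r.
have [/= e' ee'] := dvdpP _ _ e1.
exists (polyL L (e' * s) * th), (e' * b), (e' * a); split.
- by apply: in_ringintM (Oth); apply: in_ringint_poly.
- rewrite mulrA -rmorphM (_ : I * (e' * s) = e' * delta); last first.
    by rewrite sE -[e' * delta]mul1r -ss; ring.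
  by rewrite rmorphM -mulrA thE /ypoly !rmorphM ee' rmorphM; ring.
move=> z /spanw[c' [-> _]].
exists (\sum_i c' i * (st i).1), (\sum_i c' i * (st i).2).
exists (\sum_i c' i * q i * (e * s)).
rewrite !rmorph_sum !mulr_suml -!big_split /=; apply: eq_bigr => i _.
have [wi _] := stE i.
have thK : polyL L (e * s) * (polyL L (e' * s) * th) = th.
  rewrite mulrA -rmorphM (_ : _ * _ = (s * s) * (e' * e)); last by ring.
  by rewrite ss -ee' mulr1 rmorph1 mul1r.
by rewrite [w`_i]wi -[in LHS]thK; ring.
Qed.

(** All of this expresses that the coordinates [a, b, c] of [y * theta] and
    [a', b', c'] of [theta^2] on [1, y, theta] are polynomials: multiply by [I],
    respectively [I^2], and compare the coefficients on [1, y, y^2]. *)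
Lemma generator_congruences theta u v :
  polyL L I * theta = ypoly v u 1 -> in_ringint theta ->
  (forall z, in_ringint z ->
     exists a b c, z = polyL L a + polyL L b * y + polyL L c * theta) ->
  [/\ I %| A - 3%:R * u ^+ 2, I %| v + 2%:R * u ^+ 2, I %| B - 2%:R * u ^+ 3
    & I ^+ 2 %| u ^+ 3 - A * u + B].
Proof.
move=> thE Oth spanth.
have y3 := cubic_rel; have y4 := cubic_rel4.
have [a [b [c e1]]] := spanth _ (in_ringintM in_ringint_y Oth).
have [a' [b' [c' e2]]] := spanth _ (in_ringintM Oth Oth).
have [e10 e11 e12] : [/\ - B = I * a + c * v, v + A = I * b + c * u & u = c].
  apply: ypoly_inj; transitivity (y * (polyL L I * theta)).
    by rewrite thE /ypoly !rmorphD rmorphN rmorph1 /=; ring: y3.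
  by rewrite mulrCA e1 !mulrDr ![polyL L I * (_ * theta)]mulrCA thE /ypoly; ring.
have [e20 e21 e22] : [/\ v ^+ 2 - 2%:R * u * B = I ^+ 2 * a' + I * c' * v,
    - B + 2%:R * u * A + 2%:R * u * v = I ^+ 2 * b' + I * c' * u
    & A + u ^+ 2 + 2%:R * v = I * c'].
  apply: ypoly_inj; transitivity ((polyL L I * theta) ^+ 2).
    by rewrite thE /ypoly; ring: y3 y4.
  transitivity (polyL L (I ^+ 2) * (theta * theta)); first by rewrite rmorphXn; ring.
  transitivity (polyL L (I ^+ 2 * a') + polyL L (I ^+ 2 * b') * y
                + polyL L (I * c') * (polyL L I * theta)); first by rewrite e2; ring.
  by rewrite thE /ypoly; ring.
rewrite -{}e12 in e10 e11.
have Ia : I * a = - B - u * v by rewrite e10; ring.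
have Ib : I * b = v + A - u * u by rewrite e11; ring.
have I2b' : I ^+ 2 * b' = - B + 2%:R * u * A + 2%:R * u * v - (A + u ^+ 2 + 2%:R * v) * u.
  by rewrite e21 e22; ring.
have Ic' := esym e22.
split; apply/dvdpP.
- exists (2%:R * b - c'); transitivity (2%:R * (I * b) - I * c'); last by ring.
  by rewrite Ib Ic'; ring.
- exists (c' - b); transitivity (I * c' - I * b); last by ring.
  by rewrite Ib Ic'; ring.
- exists (- a - u * (c' - b)).
  transitivity (- (I * a) - u * (I * c' - I * b)); last by ring.
  by rewrite Ia Ib Ic'; ring.
- by exists (- b'); rewrite mulNr [b' * _]mulrC I2b'; ring.
Qed.

End Cubic.

(** Congruences modulo [I] for the numerator change the third member of the basis
    by an element of [R + R y], which is a unitriangular change of basis. *)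
Lemma integral_basis_shift (F : fieldType) (L : fieldExtType (ratfun F))
    (A B : {poly F}) (y : L) (std : standard_form A B y)
    (I u v U V W : {poly F}) (theta : L) :
  I != 0 -> polyL L I * theta = ypoly y v u 1 -> in_ringint theta ->
  (forall z, in_ringint z ->
     exists a b c, z = polyL L a + polyL L b * y + polyL L c * theta) ->
  I %| U - u -> I %| V - v ->
  integral_basis
    [tuple 1; y + polyL L W; (y ^+ 2 + polyL L U * y + polyL L V) / polyL L I].
Proof.
move=> I0 thE Oth spanth /dvdpP[l UE] /dvdpP[m VE].
set omega := _ / _.
have I0' : polyL L I != 0 by rewrite polyL_eq0.
have omE : polyL L I * omega = ypoly y V U 1.
  by rewrite mulrC divfK // /ypoly rmorph1; ring.
have om_th : omega = theta + polyL L l * y + polyL L m.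
  apply: (mulfI I0'); rewrite omE 2!mulrDr thE.
  by rewrite -(subrK u U) -(subrK v V) UE VE /ypoly; ring.
have Oy := in_ringint_y std.
split=> [|z Oz].
  case=> [[|[|[|i]]] //= _]; first exact: integral1.
    exact/in_ringintD/in_ringint_poly.
  rewrite om_th; apply/in_ringintD/in_ringint_poly; apply: in_ringintD => //.
  by apply/in_ringintM: Oy; apply: in_ringint_poly.
have sumE (c : {ffun 'I_3 -> {poly F}}) :
    \sum_(i < 3) polyL L (c i) * [tuple 1; y + polyL L W; omega]`_i
    = polyL L (c (inord 0)) + polyL L (c (inord 1)) * (y + polyL L W)
      + polyL L (c (inord 2)) * omega.
  rewrite !big_ord_recr big_ord0 /= add0r mulr1.
  by congr (polyL L (c _) + polyL L (c _) * _ + polyL L (c _) * _);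
    apply/val_inj; rewrite /= inordK.
have [a [b [c zE]]] := spanth z Oz.
pose b' := b - c * l; pose a' := a - c * m - b' * W.
exists [ffun i : 'I_3 => nth 0 [:: a'; b'; c] i]; split=> [|d zd].
  by rewrite sumE !ffunE !inordK //= om_th zE /a' /b'; ring.
have [d0 d1 d2] : [/\ I * a' + I * b' * W + c * V
      = I * d (inord 0) + I * d (inord 1) * W + d (inord 2) * V,
    I * b' + c * U = I * d (inord 1) + d (inord 2) * U & c = d (inord 2)].
  apply: (ypoly_inj std); transitivity (polyL L I * z).
    transitivity (polyL L (I * a) + polyL L (I * b) * y
                  + polyL L c * (polyL L I * theta)); last by rewrite zE; ring.
    by rewrite thE /ypoly /a' /b' -(subrK u U) -(subrK v V) UE VE; ring.
  rewrite zd sumE; transitivity (polyL L (I * d (inord 0))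
      + polyL L (I * d (inord 1)) * (y + polyL L W)
      + polyL L (d (inord 2)) * (polyL L I * omega)); first by ring.
  by rewrite omE /ypoly; ring.
rewrite -d2 in d0 d1; have {}d1 := mulfI I0 (addIr _ d1).
rewrite -d1 in d0; have {}d0 := mulfI I0 (addIr _ (addIr _ d0)).
apply/ffunP => i; rewrite ffunE.
by case: i => [[|[|[|i]]] //= lt_i]; rewrite ?d0 ?d1 ?d2; congr (d _);
  apply/val_inj; rewrite /= inordK.
Qed.

Theorem theorem2p3p3 (F : finFieldType) (p : nat)
    (charF : p \in [pchar F]) (p_ge5 : (5 <= p)%N)
    (L : fieldExtType (ratfun F)) (A B : {poly F}) (y : L)
    (std : standard_form A B y)
    (I : {poly F}) (indI : is_index y I)
    (G : {poly F}) (defG : G %= gcdp I A)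
    (U V W : {poly F})
    (congrU : congrp_frac (I %/ G) U (3%:R *: B) (2%:R *: A))
    (congrU0 : congrp G U 0)
    (congrV : congrp (I ^+ 2) V (- (2%:R *: U ^+ 2)))
    (congrUA : congrp (I ^+ 2) (- (2%:R *: U ^+ 2)) (- ((2%:R / 3%:R) *: A))) :
  integral_basis
    [tuple 1; y + polyL L W; (y ^+ 2 + polyL L U * y + polyL L V) / polyL L I].
Proof.
have small_neq0 n : (0 < n < 5)%N -> n%:R != 0 :> F.
  move=> /andP[n0 n5]; rewrite -(dvdn_pcharf charF).
  by rewrite gtnNdvd // (leq_trans n5).
have two0 : 2%:R != 0 :> F by apply: small_neq0.
have three0 : 3%:R != 0 :> F by apply: small_neq0.
have [w basis_w disc_y] := indI.
have [theta [u [v [Oth thE spanth]]]] :=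
  exists_reduced_generator std two0 three0 basis_w disc_y.
have I0 := index_neq0 std three0 disc_y.
have [Iu2 Iv Iu3 If] := generator_congruences std thE Oth spanth.
have GI : G %| I by rewrite (eqp_dvdl _ defG) dvdp_gcdl.
have GA : G %| A by rewrite (eqp_dvdl _ defG) dvdp_gcdr.
have II2 : I %| I ^+ 2 by rewrite expr2 dvdp_mulr.
have scal (n : nat) (P : {poly F}) : n%:R *: P = n%:R * P.
  by rewrite scaler_nat mulr_natl.
case: congrU => Q' JQ JU; rewrite /congrp !scal in JQ JU congrU0 congrV congrUA.
rewrite subr0 in congrU0; rewrite opprK in congrV.
have IUA : I ^+ 2 %| A - 3%:R * U ^+ 2.
  rewrite -(dvdpZr _ _ (c := 2%:R / 3%:R)) ?mulf_neq0 ?invr_neq0 //.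
  rewrite (_ : _ *: _ = - (2%:R * U ^+ 2) - - (2%:R / 3%:R *: A)) //.
  by rewrite opprK [RHS]addrC scalerBr -!scal scalerA divfK.
have IU : I %| U - u.
  exact: (index_congruence three0 (standard_reduced std) I0 GI GA Iu2 Iu3 If IUA
            congrU0 JQ JU).
apply: (integral_basis_shift std W I0 thE Oth spanth IU).
have -> : V - v = (V + 2%:R * U ^+ 2) - 2%:R * (U + u) * (U - u) - (v + 2%:R * u ^+ 2).
  by ring.
apply: dvdp_sub => //; apply: dvdp_sub; last exact: dvdp_mull.
exact: dvdp_trans congrV.
Qed.
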